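(* Let $T$ be a $k$-clipped decision tree over Boolean variables and let $p\in[0,1]$. Then for every $t\in\mathbb{N}$, \[ \Pr_{\rho\sim\mathcal{R}_p}\big[\mathrm{depth}(T\restriction\rho)\ge t\big]\le (2pk2^k)^t. \]
   Context: $\mathcal{R}_p$ is the distribution on restrictions that independently sets each variable to $*$ (left free) with probability $p$, and to $0$ or to $1$ with probability $(1-p)/2$ each. For a decision tree $T$ and restriction $\rho$, $T\restriction\rho$ is obtained by replacing every subtree querying a variable $e$ with $\rho(e)=b\in\{0,1\}$ by its $b$-child subtree (recursively), keeping queries to variables with $\rho(e)=*$. Decision trees are proper (no variable queried twice on a branch) with leaves labelled in $\{0,1\}$. A decision tree is $k$-clipped if from every node of the tree there is a choice of at most $k$ decisions (edges) leading to a leaf. *)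

(* Defs.v *)
From mathcomp Require Import all_boot all_order all_algebra.
From mathcomp Require Import reals.

Set Implicit Arguments.
Unset Strict Implicit.
Unset Printing Implicit Defensive.

Import GRing.Theory Num.Theory.
Local Open Scope ring_scope.

Section DecisionTrees.
Variable V : finType.

(* [Query v T0 T1] queries [v] and continues with [Tb] on answer [b]. *)
Inductive dtree : Type :=
| Leaf of bool
| Query of V & dtree & dtree.

Fixpoint dtree_depth (T : dtree) : nat :=
  match T with
  | Leaf _ => 0%N
  | Query _ T0 T1 => (maxn (dtree_depth T0) (dtree_depth T1)).+1
  end.

Definition is_leaf (T : dtree) : bool := if T is Leaf _ then true else false.

(* The sequences of variables queried along the root-to-leaf branches. *)
Fixpoint branches (T : dtree) : seq (seq V) :=
  match T with
  | Leaf _ => [:: [::]]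
  | Query v T0 T1 => [seq v :: s | s <- branches T0 ++ branches T1]
  end.

Definition proper_dtree (T : dtree) : bool := all uniq (branches T).

(* The node reached from the root by the decisions [ds], represented by the
   subtree rooted there; [None] if [ds] runs past a leaf. *)
Fixpoint descend (T : dtree) (ds : seq bool) : option dtree :=
  match ds, T with
  | [::], _ => Some T
  | d :: ds', Query _ T0 T1 => descend (if d then T1 else T0) ds'
  | _ :: _, Leaf _ => None
  end.

Definition node_of (T S : dtree) : Prop :=
  exists ds : seq bool, descend T ds = Some S.

Definition clipped_dtree (k : nat) (T : dtree) : Prop :=
  forall S : dtree, node_of T S ->
    exists (ds : seq bool) (L : dtree),
      [/\ (size ds <= k)%N, descend S ds = Some L & is_leaf L].

(* [None] stands for the star. *)
Definition restriction : Type := {ffun V -> option bool}.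

Fixpoint restrict_dtree (T : dtree) (rho : restriction) : dtree :=
  match T with
  | Leaf b => Leaf b
  | Query v T0 T1 =>
      match rho v with
      | Some b => if b then restrict_dtree T1 rho else restrict_dtree T0 rho
      | None => Query v (restrict_dtree T0 rho) (restrict_dtree T1 rho)
      end
  end.

(* The probability mass function of R_p. *)
Definition Rp_mass (R : realType) (p : R) (rho : restriction) : R :=
  \prod_(v : V) (if rho v is Some _ then (1 - p) / 2 else p).

Definition Pr_Rp (R : realType) (p : R) (E : pred restriction) : R :=
  \sum_(rho : {ffun V -> option bool} | E rho) Rp_mass p rho.

End DecisionTrees.

Arguments Leaf {V}.

(* Main.v *)
Require Import Defs.
From mathcomp Require Import all_boot all_order all_algebra.
From mathcomp Require Import reals.
From mathcomp Require Import ring lra zify.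

Set Implicit Arguments.
Unset Strict Implicit.
Unset Printing Implicit Defensive.

Import Order.TTheory GRing.Theory Num.Theory.
Local Open Scope ring_scope.

(* A restriction drives a random walk down [T]: at a query the walk meets a
   star with probability [p] and otherwise moves to a uniform child.  To have
   [depth (T|rho) >= t.+1] the walk must meet a star, and after the first star
   one of the two children must have depth at least [t] under [rho], which costs
   a factor 2 by the union bound; properness makes the children independent of
   the star.  The probability of meeting a star is at most [p] times the expected
   length of the uniform walk, and if the nearest leaf is at distance [m] that
   length is at most [2^(k+1) - 2^(k+1-m)], since every node has a leaf within
   distance [k].  Finally [2^(k+1) - 2 <= k 2^k]. *)

Section Trees.
Variable V : finType.
Implicit Types (T : dtree V) (v : V) (rho : restriction V).

Fixpoint min_depth T : nat :=
  if T is Query _ T0 T1 then (minn (min_depth T0) (min_depth T1)).+1 else 0%N.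

Lemma min_depth_descend T ds L :
  descend T ds = Some L -> is_leaf L -> (min_depth T <= size ds)%N.
Proof.
elim: T ds => [b|v T0 IH0 T1 IH1] [|d ds] //= => [[<-]//|dsL leafL].
by case: d dsL => dsL; [have := IH1 _ dsL leafL | have := IH0 _ dsL leafL]; lia.
Qed.

Lemma clipped_min_depth k T : clipped_dtree k T -> (min_depth T <= k)%N.
Proof.
have rootT : node_of T T by exists [::]; case: T.
case/(_ T rootT) => ds [L [le_k dsL leafL]].
exact: leq_trans (min_depth_descend dsL leafL) le_k.
Qed.

Lemma clipped_child k v T0 T1 (b : bool) :
  clipped_dtree k (Query v T0 T1) -> clipped_dtree k (if b then T1 else T0).
Proof. by move=> clT S [ds dsS]; apply: clT; exists (b :: ds). Qed.

Definition unqueried v T : bool := all (fun s => v \notin s) (branches T).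

Lemma proper_children v T0 T1 : proper_dtree (Query v T0 T1) ->
  [/\ proper_dtree T0, proper_dtree T1, unqueried v T0 & unqueried v T1].
Proof.
rewrite /proper_dtree /unqueried /= all_map all_cat => /andP[h0 h1].
by split; [apply: sub_all h0 | apply: sub_all h1 | apply: sub_all h0
  | apply: sub_all h1] => s /andP[].
Qed.

(** Restricting only consults [rho] at variables queried in the tree, and [v] is none of them. This
    is the source of independence for the children of a query to [v]. *)
Lemma restrict_dtree_unqueried v T rho rho' : unqueried v T ->
  (forall u, u != v -> rho u = rho' u) ->
  restrict_dtree T rho = restrict_dtree T rho'.
Proof.
move=> vT eq_rho; elim: T vT => [b|u T0 IH0 T1 IH1] //.
rewrite /unqueried /= all_map all_cat => /andP[h0 h1].
have split_cons (s : seq (seq V)) :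
    all (preim (cons u) (fun s => v \notin s)) s ->
    all (fun s => v \notin s) s.
  by apply: sub_all => x /=; rewrite inE negb_or => /andP[].
have [uv|neq_uv] := eqVneq u v; last first.
  by rewrite -eq_rho // IH0 ?IH1 //; apply: split_cons.
(* A root query to [v] contradicts [unqueried] only if some branch passes through it; on an empty
   list [all] would hold vacuously. *)
have branches_neq0 (T : dtree V) : branches T != [::].
  by elim: T => //= w S0 IHS0 S1 _; case: (branches S0) IHS0.
by move: h0 (branches_neq0 T0); case: (branches T0) => //= s ?;
  rewrite inE uv eqxx.
Qed.

End Trees.

Section Probability.
Variables (R : realType) (V : finType) (p : R).
Hypothesis p01 : 0 <= p <= 1.
Implicit Types (E F : pred (restriction V)) (c : option bool) (v : V).

Let weight c : R := if c is Some _ then (1 - p) / 2 else p.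

Lemma weight_ge0 c : 0 <= weight c.
Proof.
by case/andP: p01 => p_ge0 p_le1; case: c => [b|]; rewrite /weight; lra.
Qed.

Lemma sum_option_bool (F : option bool -> R) :
  \sum_c F c = F None + F (Some false) + F (Some true).
Proof.
rewrite (bigD1 None) //= (bigD1 (Some false)) //= (bigD1 (Some true)) //=.
by rewrite big1 ?addr0 ?addrA // => -[[]|].
Qed.

Lemma sum_weight : \sum_c weight c = 1.
Proof. by rewrite sum_option_bool /weight; lra. Qed.

Lemma Rp_mass_ge0 (rho : restriction V) : 0 <= Rp_mass p rho.
Proof. by apply: prodr_ge0 => v _; apply: weight_ge0. Qed.

Lemma Pr_Rp_predT : Pr_Rp p (fun _ : restriction V => true) = 1.
Proof.
rewrite /Pr_Rp /Rp_mass -(bigA_distr_bigA (fun=> weight)) /=.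
by rewrite big1 // => v _; exact: sum_weight.
Qed.

Lemma eq_Pr_Rp E F : E =1 F -> Pr_Rp p E = Pr_Rp p F.
Proof. by move=> eqEF; apply: eq_bigl. Qed.

Lemma Pr_Rp_union E F :
  Pr_Rp p (fun rho => E rho || F rho) <= Pr_Rp p E + Pr_Rp p F.
Proof.
rewrite /Pr_Rp [leLHS]big_mkcond (big_mkcond E) (big_mkcond F) -big_split /=.
apply: ler_sum => rho _; have := Rp_mass_ge0 rho.
by case: (E rho); case: (F rho) => /=; lra.
Qed.

Lemma Pr_Rp_partition v E :
  Pr_Rp p E = \sum_c Pr_Rp p (fun rho => (rho v == c) && E rho).
Proof.
rewrite /Pr_Rp (partition_big (fun rho : restriction V => rho v) predT) //=.
by apply: eq_bigr => c _; apply: eq_bigl => rho; rewrite andbC.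
Qed.

(** The mass is the weight at [v] times the product [rest] over the other variables. Neither [rest]
    nor [E] sees the value at [v], so the sum [S c'] of [rest] over a fibre is the same for all
    [c']; as the weights sum to 1, it equals the probability of [E]. *)
Lemma Pr_Rp_indep v c E :
    (forall rho rho' : restriction V,
       (forall u, u != v -> rho u = rho' u) -> E rho = E rho') ->
  Pr_Rp p (fun rho => (rho v == c) && E rho) = weight c * Pr_Rp p E.
Proof.
move=> indepE.
pose rest (rho : restriction V) := \prod_(u | u != v) weight (rho u).
pose upd c' (rho : restriction V) : restriction V :=
  [ffun u => if u == v then c' else rho u].
pose S c' := \sum_(rho : restriction V | (rho v == c') && E rho) rest rho.
have PrS c' : Pr_Rp p (fun rho => (rho v == c') && E rho) = weight c' * S c'.
  rewrite /Pr_Rp /S mulr_sumr; apply: eq_bigr => rho /andP[/eqP <- _].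
  by rewrite /Rp_mass (bigD1 v).
have eqS c' : S c' = S c.
  (* Overwriting the value at [v] maps the fibre over [c] bijectively onto the fibre over [c']. *)
  rewrite /S (reindex_onto (upd c') (upd c)) /=; last first.
    move=> rho /andP[/eqP rhov _]; apply/ffunP => u; rewrite !ffunE.
    by case: eqVneq => // ->.
  have upd_off c1 rho (u : V) : u != v -> upd c1 rho u = rho u.
    by rewrite ffunE => /negPf ->.
  apply: eq_big => [rho|rho _]; last first.
    by apply: eq_bigr => u uv; rewrite upd_off.
  rewrite (indepE _ rho) => [|u uv]; last exact: upd_off.
  rewrite ffunE eqxx eqxx /= andbC; congr (_ && _).
  apply/eqP/eqP => [<-|rhov]; first by rewrite ffunE eqxx.
  by apply/ffunP => u; rewrite !ffunE; case: eqVneq => // ->.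
rewrite PrS (Pr_Rp_partition v E); congr (_ * _).
under eq_bigr => c' _ do rewrite PrS eqS.
by rewrite -mulr_suml sum_weight mul1r.
Qed.

Definition Pr_depth_ge (T : dtree V) (t : nat) : R :=
  Pr_Rp p (fun rho => t <= dtree_depth (restrict_dtree T rho))%N.

Lemma Pr_depth_ge_Leaf b t : Pr_depth_ge (Leaf b) t.+1 = 0.
Proof. exact: big_pred0. Qed.

Lemma Pr_depth_ge_Query v T0 T1 t : unqueried v T0 -> unqueried v T1 ->
  Pr_depth_ge (Query v T0 T1) t.+1 <=
    p * (Pr_depth_ge T0 t + Pr_depth_ge T1 t) +
    (1 - p) / 2 * (Pr_depth_ge T0 t.+1 + Pr_depth_ge T1 t.+1).
Proof.
move=> vT0 vT1; rewrite /Pr_depth_ge (Pr_Rp_partition v) sum_option_bool.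
have indep T n : unqueried v T -> forall rho rho' : restriction V,
    (forall u, u != v -> rho u = rho' u) ->
    (n <= dtree_depth (restrict_dtree T rho))%N =
    (n <= dtree_depth (restrict_dtree T rho'))%N.
  by move=> vT rho rho' /(restrict_dtree_unqueried vT) ->.
rewrite [X in _ <= _ + X]mulrDr addrA; apply: lerD; first apply: lerD.
- pose E (rho : restriction V) :=
    ((t <= dtree_depth (restrict_dtree T0 rho)) ||
     (t <= dtree_depth (restrict_dtree T1 rho)))%N.
  (* At a star the query survives and adds 1 to the depth, so some child must reach depth [t]. *)
  rewrite (@eq_Pr_Rp _ (fun rho => (rho v == None) && E rho)) => [|rho].
    rewrite Pr_Rp_indep => [|rho rho' eq_rho].
      by apply: ler_wpM2l (Pr_Rp_union _ _); apply: (weight_ge0 None).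
    by rewrite /E (indep _ _ vT0 _ _ eq_rho) (indep _ _ vT1 _ _ eq_rho).
  by rewrite /=; case: (rho v) => //=; rewrite ltnS leq_max.
(* Once [rho v] is fixed, the restricted tree is that of the chosen child, and the two events
   coincide. *)
- rewrite -(Pr_Rp_indep (Some false) (indep _ _ vT0)).
  rewrite le_eqVlt; apply/orP; left; apply/eqP/eq_Pr_Rp => rho /=.
  by case: (rho v) => // -[].
- rewrite -(Pr_Rp_indep (Some true) (indep _ _ vT1)).
  rewrite le_eqVlt; apply/orP; left; apply/eqP/eq_Pr_Rp => rho /=.
  by case: (rho v) => // -[].
Qed.

Lemma Pr_depth_ge_ge0 T t : 0 <= Pr_depth_ge T t.
Proof. by apply: sumr_ge0 => rho _; apply: Rp_mass_ge0. Qed.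

(** Each star met costs at most [2 * M]; the last factor bounds the expected length of the walk. It
    vanishes at a leaf, and at a query it is at least 1 plus the average of its values at the
    children. *)
Lemma Pr_depth_ge_step k t (M : R) :
    (forall T, proper_dtree T -> clipped_dtree k T -> Pr_depth_ge T t <= M) ->
  forall T, proper_dtree T -> clipped_dtree k T ->
  Pr_depth_ge T t.+1 <= 2 * p * M * (2 ^+ k.+1 - 2 ^+ (k.+1 - min_depth T)).
Proof.
move=> boundM; elim=> [b|v T0 IH0 T1 IH1] Tproper Tclipped.
  by rewrite Pr_depth_ge_Leaf subn0 subrr mulr0.
have [T0proper T1proper vT0 vT1] := proper_children Tproper.
have T0clipped := @clipped_child _ _ _ _ _ false Tclipped.
have T1clipped := @clipped_child _ _ _ _ _ true Tclipped.
apply: le_trans (Pr_depth_ge_Query _ vT0 vT1) _.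
have M0 := boundM _ T0proper T0clipped; have M1 := boundM _ T1proper T1clipped.
have {IH0} := IH0 T0proper T0clipped; have {IH1} := IH1 T1proper T1clipped.
have le0 := clipped_min_depth T0clipped; have le1 := clipped_min_depth T1clipped.
rewrite /= subSS (subSn le0) (subSn le1) !exprS.
set m0 := min_depth T0 in le0 *; set m1 := min_depth T1 in le1 *.
(* This is the recurrence for the length bound: one term on the right equals the power on the left,
   the other is at least 1. *)
have pow_min : 2 ^+ (k - minn m0 m1) + 1 <= 2 ^+ (k - m0) + 2 ^+ (k - m1) :> R.
  have ge1 n : 1 <= 2 ^+ n :> R by rewrite exprn_ege1 ?ler1n.
  have [_|_] := leqP m0 m1; have := ge1 (k - m0)%N; have := ge1 (k - m1)%N; lra.
have M_ge0 : 0 <= M by apply: le_trans M0; exact: Pr_depth_ge_ge0.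
have pM_ge0 : 0 <= p * M by apply: mulr_ge0 => //; case/andP: p01.
have := Pr_depth_ge_ge0 T0 t.+1; have := Pr_depth_ge_ge0 T1 t.+1.
move: (Pr_depth_ge T0 t.+1) (Pr_depth_ge T1 t.+1) => f0 f1 f1_ge0 f0_ge0.
move: (Pr_depth_ge T0 t) (Pr_depth_ge T1 t) M0 M1 => g0 g1 M0 M1 IH1 IH0.
have star : p * (g0 + g1) <= 2 * (p * M).
  by rewrite mulrCA; apply: ler_wpM2l; [case/andP: p01 | lra].
(* Dropping the factor [1 - p] lets the walk continue past stars, as the uniform walk does. *)
have fixed : (1 - p) / 2 * (f0 + f1) <= (f0 + f1) / 2.
  have : 0 <= p * (f0 + f1) by apply: mulr_ge0; [case/andP: p01 | lra].
  lra.
apply: le_trans (lerD star fixed) _.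
have := ler_wpM2l pM_ge0 pow_min.
move: IH0 IH1; rewrite -!mulrA; lra.
Qed.

End Probability.

Lemma expected_length_bound (R : realType) (k : nat) :
  2 ^+ k.+1 - 2 <= k%:R * 2 ^+ k :> R.
Proof.
case: k => [|[|k]]; rewrite ?expr1 ?expr0; [lra | lra |].
have : 0 <= k%:R * 2 ^+ k.+2 :> R by rewrite mulr_ge0 ?exprn_ge0 ?ler0n.
rewrite -[k.+2]addn2 natrD mulrDl exprS; lra.
Qed.

Theorem theorem6p5 (R : realType) (V : finType) (T : dtree V) (k : nat) (p : R)
    (Tproper : proper_dtree T) (Tclipped : clipped_dtree k T) (p01 : 0 <= p <= 1) (t : nat) :
  Pr_Rp p (fun rho : restriction V => t <= dtree_depth (restrict_dtree T rho))%N
    <= (2 * p * k%:R * 2 ^+ k) ^+ t.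
Proof.
rewrite -/(Pr_depth_ge p T t).
(* [T] stays general because the bound for [t] is applied at every subtree. *)
elim: t T Tproper Tclipped => [|t IH] T Tproper Tclipped.
  by rewrite expr0 /Pr_depth_ge Pr_Rp_predT.
apply: le_trans (Pr_depth_ge_step p01 IH Tproper Tclipped) _.
have p_ge0 : 0 <= p by case/andP: p01.
have le_m := clipped_min_depth Tclipped.
set M := _ ^+ t; have M_ge0 : 0 <= M.
  by rewrite exprn_ge0 // !mulr_ge0 ?exprn_ge0 ?ler0n.
rewrite [leRHS]exprS -/M [leRHS](_ : _ = 2 * p * M * (k%:R * 2 ^+ k)); last by ring.
apply: ler_wpM2l; first by rewrite !mulr_ge0.
apply: le_trans (expected_length_bound R k).
(* Since [min_depth T <= k], the subtracted power is at least 2. *)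
rewrite lerD2l lerN2 subSn // exprS.
have : 1 <= 2 ^+ (k - min_depth T) :> R by rewrite exprn_ege1 ?ler1n.
lra.
Qed.
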